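(* Let $\boldsymbol{\beta}=(\beta_1,\dots,\beta_p)$ be an alternate base with Property (F) such that $\delta=\prod_{i=1}^p\beta_i$ is a Pisot unit. Then for every $i=1,\dots,p$ the shifted base $\boldsymbol{\beta}^{(i)}=(\beta_i,\beta_{i+1},\dots,\beta_{i+p-1})$ (indices modulo $p$) has Property (PP).
   Context: An alternate base is a $p$-tuple $\boldsymbol{\beta}=(\beta_1,\dots,\beta_p)$ of reals $\beta_i>1$, identified with the purely periodic sequence $(\beta_k)_{k\ge1}$, $\beta_{k+p}=\beta_k$. For $x\in[0,1)$ the $\boldsymbol{\beta}$-expansion $d_{\boldsymbol{\beta}}(x)=a_1a_2\cdots$ is given by the greedy algorithm $r_0=x$, $a_{k+1}=\lfloor\beta_{k+1}r_k\rfloor$, $r_{k+1}=\beta_{k+1}r_k-a_{k+1}$. $\mathrm{Fin}(\boldsymbol{\beta})$ is the set of $x\in[0,1)$ whose $\boldsymbol{\beta}$-expansion has only finitely many nonzero digits. $\boldsymbol{\beta}$ has Property (F) if for all $x,y\in\mathrm{Fin}(\boldsymbol{\beta})$: $x+y\in[0,1)$ implies $x+y\in\mathrm{Fin}(\boldsymbol{\beta})$, and $x-y\in[0,1)$ implies $x-y\in\mathrm{Fin}(\boldsymbol{\beta})$. $\boldsymbol{\beta}$ has Property (PP) if there exists $\gamma>0$ such that $d_{\boldsymbol{\beta}}(x)$ is purely periodic for every rational $x\in[0,\gamma)$. A Pisot unit is an algebraic unit $\delta>1$ all of whose other conjugates have modulus $<1$. *)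

(* Defs.v *)
From HB Require Import structures.
From mathcomp Require Import all_boot all_order all_algebra.
From mathcomp Require Import reals.
From mathcomp Require Import complex.
Set Implicit Arguments. Unset Strict Implicit. Unset Printing Implicit Defensive.
Import Order.TTheory GRing.Theory Num.Theory.
Local Open Scope ring_scope.

Section AltBase.
Variable R : realType.

Definition alt_base (beta : seq R) : Prop :=
  (0 < size beta)%N /\ forall b, b \in beta -> 1 < b.

(* beta_{k+1} of the periodic sequence (0-indexed: bterm beta k = beta_{k+1}) *)
Definition bterm (beta : seq R) (k : nat) : R :=
  nth 0 beta (k %% size beta).

Fixpoint rem_seq (beta : seq R) (x : R) (k : nat) : R :=
  match k with
  | 0 => x
  | k'.+1 => let y := bterm beta k' * rem_seq beta x k' in y - (Num.floor y)%:~R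
  end.

(* digits: digit beta x k = a_{k+1} = floor (beta_{k+1} r_k) *)
Definition digit (beta : seq R) (x : R) (k : nat) : int :=
  Num.floor (bterm beta k * rem_seq beta x k).

Definition Fin (beta : seq R) (x : R) : Prop :=
  0 <= x < 1 /\ exists N : nat, forall k : nat, (N <= k)%N -> digit beta x k = 0.

Definition propF (beta : seq R) : Prop :=
  forall x y : R, Fin beta x -> Fin beta y ->
    (0 <= x + y < 1 -> Fin beta (x + y)) /\
    (0 <= x - y < 1 -> Fin beta (x - y)).

Definition purely_periodic (beta : seq R) (x : R) : Prop :=
  exists n : nat, (0 < n)%N /\ forall k : nat, digit beta x (k + n) = digit beta x k.

Definition propPP (beta : seq R) : Prop :=
  exists gamma : R, 0 < gamma /\
    forall q : rat, 0 <= (ratr q : R) -> (ratr q : R) < gamma -> purely_periodic beta (ratr q).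

(* Pisot unit: delta > 1 whose minimal polynomial P over Q (monic, integer
   coefficients, irreducible over Q) has constant coefficient +-1 (unit) and
   all complex roots other than delta of modulus < 1. *)
Definition pisot_unit (delta : R) : Prop :=
  1 < delta /\
  exists P : {poly int},
    P \is monic /\
    irreducible_poly (map_poly (intr : int -> rat) P) /\
    (map_poly (intr : int -> R) P).[delta] = 0 /\
    (P`_0 = 1 \/ P`_0 = -1) /\
    forall z : R[i], (map_poly (intr : int -> R[i]) P).[z] = 0 ->
      z != (delta%:C)%C -> `|z| < 1.

End AltBase.

(* Main.v *)
Require Import Defs.
From HB Require Import structures.
From mathcomp Require Import all_boot all_order all_algebra all_field.
From mathcomp Require Import reals.
From mathcomp Require Import complex.
From mathcomp Require boolp.
From mathcomp Require Import ring lra zify.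
Import Order.TTheory GRing.Theory Num.Theory.
Local Open Scope ring_scope.

(** Let [D_j] be the product of the last [p - 1 - j] bases of one period.  Property (F) lets one
    write [n / delta^m - D_j], for [n / delta^m] just above [D_j], as a combination of the [D_i]
    whose coefficients lie in [Z[delta]], are nonnegative and as small as we like.  The resulting
    linear system is a small perturbation of the identity, so by Cramer's rule every [D_j] lies in
    the fraction field of [Z[delta]]; this gives sense to the conjugates of remainders.

    Let [x >= 0] be rational and small.  As [delta] is a unit, [delta^l x - x] lies in [Z[delta]]
    for some large [l].  For [k = 0] and for a fixed [k = m], the number
    [h_k = r_{(l-k)p}(x) - x delta^{-k}] has conjugates bounded independently of [x] and [l], so it
    ranges over a finite set.  For [k = 0] and [x] below the smallest nonzero modulus in that set,
    this forces [r_{lp}(x) >= x].  Then [h_m] lies in [[0,1)] and has a finite expansion by (F); if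
    [m] was chosen larger than the lengths of all finite expansions in the finite set,
    [r_{lp}(x) - x], which is the remainder of [h_m] after [mp] steps, vanishes. *)

(** * Greedy remainders and digits in an alternate base *)

Section Remainders.
Context {R : realType} (beta : seq R).
Hypothesis hbeta : alt_base beta.
Local Notation p := (size beta).
Local Notation b := (bterm beta).
Local Notation rem := (rem_seq beta).
Local Notation delta := (\prod_(c <- beta) c).

Definition bprod (k : nat) : R := \prod_(j < k) b j.

Lemma bterm_gt1 k : 1 < b k.
Proof. by apply: hbeta.2; rewrite mem_nth // ltn_pmod // hbeta.1. Qed.

Lemma bterm_gt0 k : 0 < b k.
Proof. exact: lt_trans ltr01 (bterm_gt1 k). Qed.

Lemma bprod_ge1 k : 1 <= bprod k.
Proof.
rewrite /bprod; elim: k => [|k IH]; first by rewrite big_ord0.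
by rewrite big_ord_recr /= mulr_ege1 // ltW // bterm_gt1.
Qed.

Lemma bprod_gt0 k : 0 < bprod k.
Proof. exact: lt_le_trans ltr01 (bprod_ge1 k). Qed.

Lemma bprodS k : bprod k.+1 = bprod k * b k.
Proof. by rewrite /bprod big_ord_recr. Qed.

Lemma bterm_addM n k : b (n * p + k) = b k.
Proof. by rewrite /bterm modnMDl. Qed.

Lemma bprod_size : bprod p = delta.
Proof.
rewrite /bprod (big_nth 0) big_mkord; apply: eq_bigr => i _.
by rewrite /bterm modn_small.
Qed.

Lemma bprodMsize n : bprod (n * p) = delta ^+ n.
Proof.
elim: n => [|n IH]; first by rewrite /bprod big_ord0.
rewrite mulSnr exprSr -IH -bprod_size /bprod big_split_ord /=.
by congr (_ * _); apply: eq_bigr => i _; rewrite bterm_addM.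
Qed.

Lemma delta_gt0 : 0 < delta.
Proof. by rewrite -bprod_size bprod_gt0. Qed.

Lemma remS x k : rem x k.+1 = b k * rem x k - (digit beta x k)%:~R.
Proof. by []. Qed.

Lemma remS_itv x k : 0 <= rem x k.+1 < 1.
Proof.
rewrite remS /digit subr_ge0 floor_le /= ltrBlDr addrC.
by have := floorD1_gt (b k * rem x k); rewrite intrD.
Qed.

Lemma rem_ge0 x k : 0 <= x -> 0 <= rem x k.
Proof. by case: k => [|k] // _; case/andP: (remS_itv x k). Qed.

Lemma rem_itv x k : 0 <= x < 1 -> 0 <= rem x k < 1.
Proof. by case: k => [|k] // _; exact: remS_itv. Qed.

Lemma digit_ge0 x k : 0 <= x -> 0 <= digit beta x k.
Proof. by move=> x0; rewrite floor_ge0 mulr_ge0 ?rem_ge0 // ltW // bterm_gt0. Qed.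

Lemma digit_le x k : 0 <= x < 1 -> (digit beta x k)%:~R <= b k.
Proof.
move=> x01; apply: le_trans (floor_le _) _.
have /andP[_ /ltW h] := rem_itv x k x01.
by rewrite -[leRHS]mulr1 ler_wpM2l // ltW // bterm_gt0.
Qed.

Lemma remD x n k : rem x (n * p + k) = rem (rem x (n * p)) k.
Proof.
elim: k => [|k IH]; first by rewrite addn0.
by rewrite addnS !remS /digit IH bterm_addM.
Qed.

Lemma digitD x n k : digit beta x (n * p + k) = digit beta (rem x (n * p)) k.
Proof. by rewrite /digit remD bterm_addM. Qed.

(** Since [s] is at most the remainder after [k] steps, lowering [x] by [s / bprod k] changes none
    of the first [k] digits; the difference is merely multiplied up to [s]. *)
Lemma rem_sub x s k : 0 <= x -> 0 <= s <= rem x k ->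
  rem (x - s / bprod k) k = rem x k - s.
Proof.
move=> x0; elim: k s => [|k IH] s /andP[s0 sle].
  by rewrite /bprod big_ord0 divr1.
have b0 := bterm_gt0 k.
have hrem : rem (x - s / bprod k.+1) k = rem x k - s / b k.
  rewrite -IH; first by rewrite bprodS invfM [_^-1 * _]mulrC mulrA.
  rewrite divr_ge0 ?(ltW b0) //= ler_pdivrMr // (le_trans sle) //.
  by rewrite remS mulrC gerBl ler0z digit_ge0.
rewrite remS {1}/digit hrem mulrBr mulrCA divff ?gt_eqF // mulr1.
have /andP[r0 r1] := remS_itv x k.
rewrite (_ : Num.floor _ = digit beta x k); first by rewrite remS addrAC.
by apply: floor_def; rewrite intrD; move: sle r0 r1; rewrite remS; lra.
Qed.

Lemma rem_le x k : 0 <= x -> rem x k <= bprod k * x.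
Proof.
move=> x0; elim: k => [|k IH]; first by rewrite /bprod big_ord0 mul1r.
rewrite remS bprodS mulrAC [leRHS]mulrC.
have h : 0 <= (digit beta x k)%:~R :> R by rewrite ler0z digit_ge0.
apply: le_trans (_ : b k * rem x k <= _); first by rewrite gerBl.
by rewrite ler_pM2l ?bterm_gt0.
Qed.

(** The first [k] digits of [y / bprod k] are all 0. *)
Lemma rem_div y k : 0 <= y < 1 -> rem (y / bprod k) k = y.
Proof.
elim: k y => [|k IH] y /andP[y0 y1]; first by rewrite /bprod big_ord0 divr1.
have b0 := bterm_gt0 k.
have hrem : rem (y / bprod k.+1) k = y / b k.
  rewrite bprodS invfM [_^-1 * _]mulrC mulrA; apply: IH.
  by rewrite divr_ge0 ?(ltW b0) //= ltr_pdivrMr // mul1r (lt_trans y1) ?bterm_gt1.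
rewrite remS /digit hrem mulrCA divff ?gt_eqF // mulr1.
by rewrite (_ : Num.floor _ = 0) ?subr0 //; apply: floor_def; rewrite y0.
Qed.

Lemma div_itv (y c : R) : 1 <= c -> 0 <= y < 1 -> 0 <= y / c < 1.
Proof.
move=> c1 /andP[y0 y1]; have c0 : 0 < c by apply: lt_le_trans c1.
by rewrite divr_ge0 ?(ltW c0) //= ltr_pdivrMr // mul1r (lt_le_trans y1).
Qed.

Lemma rem_expand x k :
  rem x k = bprod k * x - \sum_(j < k) (digit beta x j)%:~R * \prod_(j.+1 <= i < k) b i.
Proof.
elim: k => [|k IH]; first by rewrite /bprod !big_ord0 mul1r subr0.
rewrite remS {1}IH bprodS big_ord_recr /= big_geq // mulr1 mulrBr opprD addrA.
congr (_ - _ - _); first by rewrite mulrA (mulrC (b k)).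
rewrite mulr_sumr; apply: eq_bigr => j _.
by rewrite big_nat_recr //= mulrCA (mulrC (b k)).
Qed.

Lemma rem_eq0_ge x k n : rem x k = 0 -> (k <= n)%N -> rem x n = 0.
Proof.
move=> h /subnKC <-; elim: (n - k)%N => [|i IH]; first by rewrite addn0.
by rewrite addnS remS /digit IH mulr0 floor0 subr0.
Qed.

End Remainders.

(** * Evaluation of integer polynomials *)

Section Evaluation.
Context {A : comNzRingType}.

(** A composition of morphisms, hence a ring morphism. One polynomial encodes an element of Z[delta]
    together with its conjugates, obtained by varying [z]. *)
Definition ev (z : A) : {poly int} -> A := horner_eval z \o map_poly intr.

HB.instance Definition _ z := GRing.RMorphism.on (ev z).

Lemma evE z a : ev z a = (map_poly intr a).[z]. Proof. by []. Qed.

Lemma evX z : ev z 'X = z.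
Proof. by rewrite evE map_polyX hornerX. Qed.

Lemma evC z (c : int) : ev z c%:P = c%:~R.
Proof. by rewrite evE map_polyC hornerC. Qed.

End Evaluation.

Lemma ev_morph (A B : comNzRingType) (f : {rmorphism A -> B}) (z : A) a : ev (f z) a = f (ev z a).
Proof.
rewrite !evE -horner_map -map_poly_comp; congr _.[_].
by apply: eq_map_poly => c /=; rewrite rmorph_int.
Qed.

(** * Integer polynomials modulo a monic polynomial *)

Section MonicRoots.
Variable P : {poly int}.
Hypothesis Pmonic : P \is monic.

Import Pdiv.CommonRing Pdiv.RingMonic.

Lemma ev_rmodp (A : comNzRingType) (z : A) a : ev z P = 0 -> ev z (rmodp a P) = ev z a.
Proof.
by move=> Pz; rewrite [in RHS](rdivp_eq Pmonic a) rmorphD rmorphM /= Pz mulr0 add0r.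
Qed.

Lemma size_rmodp_lt a : (size (rmodp a P) < size P)%N.
Proof. by rewrite ltn_rmodp monic_neq0. Qed.

(** Write P = Q X + c with c the constant coefficient. At a root z, z Q(z) = -c, and c squared is 1,
    so -c Q inverts every root at once. *)
Lemma exists_inverse_poly : (P`_0 = 1 \/ P`_0 = -1) ->
  exists U : {poly int}, forall (A : comNzRingType) (z : A), ev z P = 0 -> z * ev z U = 1.
Proof.
move=> P0.
have hP : P = drop_poly 1 P * 'X + (P`_0)%:P.
  rewrite -[LHS](poly_take_drop 1 P) addrC expr1; congr (_ + _).
  by apply/polyP => -[|k]; rewrite coef_take_poly coefC.
have sq : P`_0 * P`_0 = 1 by case: P0 => ->.
exists (- (P`_0)%:P * drop_poly 1 P) => A z; rewrite {1}hP.
rewrite !rmorphM !rmorphD !rmorphN !rmorphM /= !evC !evX => /eqP.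
rewrite addr_eq0 => /eqP h.
rewrite mulrC -mulrA h mulrNN -rmorphM sq.
by rewrite rmorph1.
Qed.

(** Pigeonhole: the powers of X^m, reduced modulo [P] and then modulo [N], take finitely many
    values, so two of them agree. The lower power is cancelled with [U], and exponents that are
    multiples of [m] ensure [m <= l]. *)
Lemma pow_sub1_divisible (U : {poly int}) (N m : nat) : (0 < N)%N -> (0 < m)%N ->
  exists l (S : {poly int}), (m <= l)%N /\
    forall (A : comNzRingType) (z : A), ev z P = 0 -> z * ev z U = 1 ->
      z ^+ l - 1 = N%:R * ev z S.
Proof.
move=> N0 m0; case: N N0 => // N _.
pose d := size P.
pose f (k : nat) : {ffun 'I_d -> 'I_N.+1} :=
  [ffun i : 'I_d => inord (absz (modz (rmodp ('X^(m * k)) P)`_i N.+1%:Z))].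
have [i [j [lij fij]]] : exists i j, (i < j)%N /\ f i = f j.
  pose n := #|{ffun 'I_d -> 'I_N.+1}|.
  have : ~ injective (fun k : 'I_n.+1 => f k).
    by move=> /leq_card; rewrite card_ord ltnn.
  move=> ninj; apply: boolp.contrapT => nex; apply: ninj => x y fxy; apply/val_inj.
  by case: (ltngtP x y) => // h; case: nex; [exists x, y | exists y, x].
pose D : {poly int} := rmodp 'X^(m * j) P - rmodp 'X^(m * i) P.
have dvdD k : (N.+1%:Z %| D`_k)%Z.
  case: (ltnP k d) => hk; last first.
    by rewrite coefB !nth_default ?subrr ?dvdz0 // (leq_trans _ hk) // ltnW // size_rmodp_lt.
  have := congr1 (fun g : {ffun 'I_d -> 'I_N.+1} => val (g (Ordinal hk))) fij.
  have lt a : (absz (modz a N.+1%:Z) < N.+1)%N.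
    by rewrite -ltz_nat gez0_abs ?modz_ge0 // ltz_pmod.
  rewrite /f !ffunE /= !inordK // => /(congr1 Posz).
  rewrite !gez0_abs ?modz_ge0 // => h.
  by rewrite coefB -eqz_mod_dvd h.
pose S0 : {poly int} := map_poly (fun c => (c %/ N.+1%:Z)%Z) D.
have hD : D = N.+1%:Z *: S0.
  by apply/polyP => k; rewrite coefZ coef_map_id0 ?div0z // mulrC divzK.
exists (m * (j - i))%N, (S0 * U ^+ (m * i)); split.
  by rewrite leq_pmulr // subn_gt0.
move=> A z Pz Uz.
have e1 : ev z D = z ^+ (m * j) - z ^+ (m * i).
  by rewrite rmorphB /= !ev_rmodp // !rmorphXn /= evX.
have e2 : ev z D = N.+1%:R * ev z S0.
  by rewrite hD -mul_polyC rmorphM /= evC.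
rewrite rmorphM rmorphXn /= mulrA -e2 e1 mulrBl -exprMn Uz expr1n mulnBr.
congr (_ - _).
have le : (m * i <= m * j)%N by rewrite leq_mul2l (ltnW lij) orbT.
by rewrite -{2}(subnK le) exprD -mulrA -exprMn Uz expr1n mulr1.
Qed.

End MonicRoots.

(** * Finiteness of elements with bounded conjugates *)

Section Finiteness.
Context {R : realType}.
Variable P : {poly int}.
Hypotheses (Pmonic : P \is monic)
  (Pirr : irreducible_poly (map_poly (intr : int -> rat) P)).

(** In characteristic 0 the derivative is nonzero and of smaller degree, so the irreducible [q]
    cannot divide it. *)
Lemma separable_of_irreducible_char0 (F : fieldType) (q : {poly F}) :
  [pchar F] =i pred0 -> irreducible_poly q -> separable_poly q.
Proof.
move=> ch0 irr; rewrite unlock irreducible_poly_coprime //.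
have sq := irr.1.
have q0 : q != 0 by rewrite -size_poly_gt0 (leq_trans _ sq).
have q'0 : q^`() != 0.
  apply/eqP => /(congr1 (fun r : {poly F} => r`_(size q).-2)) /eqP.
  rewrite coef_deriv coef0 -mulr_natr mulf_eq0 ((pcharf0P F).1 ch0) /= orbF.
  rewrite (_ : (size q).-2.+1 = (size q).-1).
    by rewrite -lead_coefE lead_coef_eq0 (negPf q0).
  by case: (size q) sq => [|[]].
apply/negP => /(dvdp_leq q'0).
by rewrite leqNgt lt_size_deriv.
Qed.

(** The roots are simple because irreducibility over the rationals gives separability, which
    survives extension to [R[i]]. *)
Lemma complex_roots : exists rs : seq R[i],
  [/\ uniq rs, (size rs).+1 = size P & forall z, ev z P = 0 <-> z \in rs].
Proof.
have [rs hrs] := closed_field_poly_normal (map_poly intr P : {poly R[i]}).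
have lc : lead_coef (map_poly intr P : {poly R[i]}) = 1.
  by apply/monicP; rewrite monic_map.
move: hrs; rewrite lc scale1r => hrs.
exists rs; split.
- rewrite -separable_prod_XsubC -hrs.
  rewrite (_ : map_poly intr P = map_poly ratr (map_poly intr P : {poly rat})).
    by rewrite separable_map; apply: separable_of_irreducible_char0 => //; exact: pchar_num.
  by rewrite -map_poly_comp; apply: eq_map_poly => c /=; rewrite ratr_int.
- by rewrite -(size_prod_XsubC rs id) -hrs size_map_poly_id0 // intr_eq0 lead_coef_eq0 monic_neq0.
- by move=> z; rewrite evE hrs -root_prod_XsubC rootE; exact: (rwP eqP).
Qed.

Lemma norm_le_real (t : R[i]) : exists c : R, 0 <= c /\ `|t| <= c%:C%C.
Proof.
by exists (Num.sqrt (complex.Re t ^+ 2 + complex.Im t ^+ 2)); rewrite sqrtr_ge0 normc_def lexx.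
Qed.

(* The coefficients of [a] modulo [P] are recovered from the conjugates by
   inverting the Vandermonde matrix of the roots. *)
Lemma finite_bounded_conjugates (delta C : R) : ev delta P = 0 ->
  exists s : seq R, forall a : {poly int},
    (forall z : R[i], ev z P = 0 -> `|ev z a| <= C%:C%C) -> ev delta a \in s.
Proof.
move=> Pd; have [rs [urs srs hrs]] := complex_roots.
pose d := size rs.
pose V := Vandermonde d (\row_(i < d) rs`_i).
have Vu : V \in unitmx.
  rewrite unitmxE det_Vandermonde unitfE; apply/prodf_neq0 => i _.
  apply/prodf_neq0 => j lij; rewrite !mxE subr_eq0 nth_uniq //.
  by rewrite gtn_eqF.
pose M := \sum_i \sum_k `|invmx V i k|.
have [c [c0 hc]] := norm_le_real (C%:C%C * M).
pose B := Num.bound c.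
have hB : c < B%:R by apply: archi_boundP.
(* The coefficients of [a] modulo [P] lie between [-B] and [B]. They are shifted by [B] to become
   ordinals, and the second sum undoes the shift. *)
exists [seq \sum_(k < d) (f k : nat)%:R * delta ^+ k - \sum_(k < d) B%:R * delta ^+ k |
          f : {ffun 'I_d -> 'I_(2 * B).+1}].
move=> a ha; rewrite -(ev_rmodp _ Pmonic _ _ _ Pd).
pose r := Pdiv.CommonRing.rmodp a P; rewrite -/r.
have szr : (size r <= d)%N by rewrite -ltnS srs size_rmodp_lt.
have evr (A : comNzRingType) (z : A) : ev z r = \sum_(k < d) (r`_k)%:~R * z ^+ k.
  rewrite evE (@horner_coef_wide _ d).
    by apply: eq_bigr => k _; rewrite coef_map.
  exact: leq_trans (size_poly _ _) szr.
pose w := \row_(i < d) ev (rs`_i) r.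
have hw : w = (\row_(k < d) (r`_k)%:~R) *m V.
  by apply/rowP => i; rewrite !mxE evr; apply: eq_bigr => k _; rewrite !mxE.
have rk k : (k < d)%N -> `|r`_k| <= B%:Z.
  move=> lk; pose k' := Ordinal lk.
  have e : (r`_k)%:~R = (w *m invmx V) 0 k' by rewrite hw mulmxK // mxE.
  suff : `|(r`_k)%:~R : R[i]| <= (B%:R : R)%:C%C.
    by rewrite rmorph_nat -intr_norm -[B%:R]/((B%:Z)%:~R) ler_int.
  apply: le_trans (_ : c%:C%C <= _); last by rewrite lecR ltW.
  apply: le_trans hc; apply: le_trans (real_ler_norm _); last first.
    by rewrite realM ?complex_real // ger0_real // sumr_ge0 // => i _; rewrite sumr_ge0.
  rewrite e mxE (le_trans (ler_norm_sum _ _ _)) // mulr_sumr ler_sum // => i _.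
  rewrite normrM mxE; apply: ler_pM => //.
    by rewrite ev_rmodp // ?ha //; apply/hrs; rewrite mem_nth.
  by rewrite (bigD1 k') //= lerDl sumr_ge0.
apply/imageP; exists [ffun k : 'I_d => inord (absz (r`_k + B%:Z)%R)] => //.
rewrite evr -sumrB; apply: eq_bigr => k _.
rewrite ffunE inordK; last by have := rk k (ltn_ord k); lia.
rewrite -mulrBl; congr (_ * _).
have -> : (absz (r`_k + B%:Z)%R)%:R = (r`_k + B%:Z)%:~R :> R.
  rewrite -[LHS]/((Posz _)%:~R) gez0_abs //.
  by have := rk k (ltn_ord k); lia.
by rewrite intrD addrK.
Qed.

End Finiteness.

(** Bernoulli's inequality reduces this to the Archimedean property. *)
Lemma expr_unbounded (R : realType) (d c : R) : 1 < d -> exists n, c < d ^+ n.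
Proof.
move=> d1; have bern n : 1 + n%:R * (d - 1) <= d ^+ n.
  elim: n => [|n IH]; first by rewrite mul0r addr0 expr0.
  have n0 : 0 <= n%:R * (d - 1) ^+ 2 by rewrite mulr_ge0 // sqr_ge0.
  rewrite exprS -natr1.
  apply: le_trans (_ : d * (1 + n%:R * (d - 1)) <= _); first by nra.
  by rewrite ler_pM2l // (lt_trans ltr01).
have d0 : 0 < d - 1 by rewrite subr_gt0.
exists (Num.bound (c / (d - 1))); apply: lt_le_trans (bern _).
have := archi_boundP (normr_ge0 (c / (d - 1))).
case: (lerP 0 c) => c0; last by have := ler0n R (Num.bound (c / (d - 1))); nra.
have h : 0 <= c / (d - 1) by rewrite divr_ge0 // ltW.
by rewrite ger0_norm // ltr_pdivrMr // => /lt_trans; apply; rewrite ltrDr.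
Qed.

(** * Finite expansions and the additive group they generate *)

Section Finite.
Context {R : realType} {beta : seq R}.
Hypotheses (hbeta : alt_base beta) (hF : propF beta).
Local Notation p := (size beta).
Local Notation b := (bterm beta).
Local Notation rem := (rem_seq beta).
Local Notation delta := (\prod_(c <- beta) c).

Lemma delta_gt1 : 1 < delta.
Proof.
rewrite -bprod_size //; case: p hbeta.1 => // k _; rewrite bprodS.
apply: lt_le_trans (bterm_gt1 _ hbeta k) _.
by rewrite ler_peMl ?bprod_ge1 // ltW // bterm_gt0.
Qed.

Lemma delta_neq0 : delta != 0.
Proof. by rewrite gt_eqF // delta_gt0. Qed.

Lemma deltaX_ge1 n : 1 <= delta ^+ n.
Proof. by rewrite exprn_ege1 // ltW // delta_gt1. Qed.

(** Once all digits are 0, each period multiplies the remainder by delta; as remainders stay below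
    1, it must be 0. *)
Lemma FinP x : Fin beta x <-> 0 <= x < 1 /\ exists N, rem x N = 0.
Proof.
split=> -[x01 [N hN]]; split=> //; last first.
  by exists N => k Nk; rewrite /digit (rem_eq0_ge _ _ _ _ hN Nk) mulr0 floor0.
exists (N * p)%N; set y := rem x (N * p).
have /andP[y0 y1] : 0 <= y < 1 by apply: rem_itv.
have dy k : digit beta y k = 0.
  by rewrite -digitD hN // (leq_trans _ (leq_addr _ _)) // leq_pmulr // hbeta.1.
apply/eqP; case: eqVneq => // ny.
have yp : 0 < y by rewrite lt_def ny.
have [n hn] := expr_unbounded R delta y^-1 delta_gt1.
have /andP[_] : 0 <= rem y (n * p) < 1 by apply: rem_itv; rewrite ?y0.
rewrite rem_expand // big1 => [|j _]; last by rewrite dy mul0r.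
rewrite subr0 bprodMsize // -ltr_pdivlMr // mul1r.
by move/(lt_trans hn); rewrite ltxx.
Qed.

(** Division by [delta ^+ n] prepends [n] periods of zero digits. *)
Lemma Fin_div x n : Fin beta x -> Fin beta (x / delta ^+ n).
Proof.
move=> /FinP[x01 [N hN]]; apply/FinP; split; first by rewrite div_itv // deltaX_ge1.
by exists (n * p + N)%N; rewrite remD -bprodMsize // rem_div.
Qed.

Lemma Fin_mul y n : 0 <= y < 1 -> Fin beta (y / delta ^+ n) -> Fin beta y.
Proof.
move=> y01 /FinP[_ [N hN]]; apply/FinP; split=> //; exists N.
have /(_ (leq_addl _ _)) := rem_eq0_ge _ _ _ (n * p + N) hN.
by rewrite remD -bprodMsize // rem_div.
Qed.

Lemma Fin0 : Fin beta 0.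
Proof. by apply/FinP; rewrite lexx ltr01; split=> //; exists 0%N. Qed.

(* For a base with property (F) this is an additive group: factors [delta^-n] make room for sums. *)
Definition finspan (y : R) : Prop :=
  exists (s : nat) (a c : R), [/\ Fin beta a, Fin beta c & y = delta ^+ s * (a - c)].

(** After division by [delta ^+ s], [y] is a difference of two finite expansions lying in [0,1), to
    which (F) applies; the leading zero periods are then removed. *)
Lemma finspan_Fin y : finspan y -> 0 <= y < 1 -> Fin beta y.
Proof.
move=> [s [a [c [fa fc ey]]]] y01; apply: (Fin_mul _ s) => //.
have e : y / delta ^+ s = a - c by rewrite ey mulrC mulKf // expf_neq0 // delta_neq0.
rewrite e; apply: (hF _ _ fa fc).2; rewrite -e; apply: div_itv => //.
exact: deltaX_ge1.
Qed.

Lemma Fin_finspan a : Fin beta a -> finspan a.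
Proof.
by move=> fa; exists 0%N, a, 0; split; [| exact: Fin0 | rewrite subr0 mul1r].
Qed.

Lemma finspan0 : finspan 0.
Proof. exact/Fin_finspan/Fin0. Qed.

Lemma finspanN y : finspan y -> finspan (- y).
Proof. by move=> [s [a [c [fa fc ->]]]]; exists s, c, a; split=> //; ring. Qed.

Lemma finspan_mul y n : finspan y -> finspan (delta ^+ n * y).
Proof.
by move=> [s [a [c [fa fc ->]]]]; exists (n + s)%N, a, c; split=> //; rewrite exprD mulrA.
Qed.

Lemma finspan_div y n : finspan y -> finspan (y / delta ^+ n).
Proof.
move=> [s [a [c [fa fc ->]]]]; exists s, (a / delta ^+ n), (c / delta ^+ n).
by split; [exact: Fin_div | exact: Fin_div | rewrite -mulrBl mulrA].
Qed.

Lemma finspanD y z : finspan y -> finspan z -> finspan (y + z).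
Proof.
move=> [s [a [c [fa fc ->]]]] [t [a' [c' [fa' fc' ->]]]].
(* The extra factor [delta ^+ n > 2] brings each summand below 1/2, so that sums stay below 1 and
   (F) applies. *)
have [n hn] := expr_unbounded R delta 2 delta_gt1.
have dn (i : nat) : delta ^+ i != 0 by rewrite expf_neq0 // delta_neq0.
have fin2 u v i j : Fin beta u -> Fin beta v ->
    Fin beta (u / delta ^+ (n + i) + v / delta ^+ (n + j)).
  move=> fu fv.
  have small w k : Fin beta w -> 0 <= w / delta ^+ (n + k) < 2^-1.
    move=> [/andP[w0 w1] _]; have := deltaX_ge1 k; rewrite exprD => dk.
    have d2 : 2 < delta ^+ n * delta ^+ k.
      by apply: lt_le_trans hn _; rewrite ler_peMr // (le_trans ler01) // deltaX_ge1.
    have d0 : 0 < delta ^+ n * delta ^+ k by apply: lt_trans d2.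
    rewrite divr_ge0 ?(ltW d0) //= ltr_pdivrMr //; lra.
  apply: (hF _ _ _ _).1; [exact: Fin_div|exact: Fin_div|].
  by have := small _ i fu; have := small _ j fv; lra.
exists (n + s + t)%N, (a / delta ^+ (n + t) + a' / delta ^+ (n + s)),
  (c / delta ^+ (n + t) + c' / delta ^+ (n + s)); split; try exact: fin2.
have := dn n; have := dn s; have := dn t.
rewrite !exprD => ? ? ?; field.
by apply/and3P; split.
Qed.

Lemma finspan_nat y n : finspan y -> finspan (n%:R * y).
Proof.
move=> fy; elim: n => [|n IH]; first by rewrite mul0r; exact: finspan0.
by rewrite -natr1 mulrDl mul1r; apply: finspanD.
Qed.

Lemma finspan_int y (c : int) : finspan y -> finspan (c%:~R * y).
Proof.
move=> fy; case: c => n; first exact: (finspan_nat _ n).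
by rewrite NegzE rmorphN mulNr; apply: finspanN; exact: (finspan_nat _ n.+1).
Qed.

Lemma finspan_sum (I : Type) (r : seq I) (F : I -> R) :
  (forall i, finspan (F i)) -> finspan (\sum_(i <- r) F i).
Proof. by move=> h; apply: big_ind => //; [exact: finspan0 | exact: finspanD]. Qed.

(** The number [D_j] of the overview: the weight of the digit at position [j] of a period in the
    remainder at the end of that period. *)
Definition tail (j : nat) : R := \prod_(j.+1 <= i < p) b i.

Lemma tail_bprod j : (j < p)%N -> bprod beta j.+1 * tail j = delta.
Proof.
by move=> lj; rewrite -bprod_size // /bprod -!(big_mkord xpredT) -big_cat_nat.
Qed.

Lemma tail_ge1 j : 1 <= tail j.
Proof.
by rewrite /tail; elim/big_ind: _ => // [x y|i _]; [exact: mulr_ege1|rewrite ltW // bterm_gt1].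
Qed.

Lemma tail_gt0 j : 0 < tail j.
Proof. exact: lt_le_trans ltr01 (tail_ge1 j). Qed.

(** Dividing by delta leaves the inverse of the first [j.+1] bases, whose expansion has the single
    nonzero digit 1, at position [j]. *)
Lemma finspan_tail j : (j < p)%N -> finspan (tail j).
Proof.
move=> lj; have e := tail_bprod j lj.
have B0 := bprod_gt0 _ hbeta j.+1; have Bj := bprod_gt0 _ hbeta j.
have b1 := bterm_gt1 _ hbeta j; have b0 := bterm_gt0 _ hbeta j.
have -> : tail j = delta ^+ 1 * (bprod beta j.+1)^-1.
  by rewrite expr1 -e mulrAC mulfV ?mul1r // gt_eqF.
apply: finspan_mul; apply: Fin_finspan; apply/FinP; split.
  rewrite invr_ge0 (ltW B0) /= invf_lt1 // bprodS.
  by apply: lt_le_trans b1 _; rewrite ler_peMl ?bprod_ge1 // ltW.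
exists j.+1; rewrite remS /digit.
have -> : rem (bprod beta j.+1)^-1 j = (b j)^-1.
  rewrite bprodS invfM mulrC; apply: rem_div => //.
  by rewrite invr_ge0 ltW //= invf_lt1.
by rewrite mulfV ?gt_eqF // floor1 subrr.
Qed.

Lemma rem_block x n : rem x (n.+1 * p) =
  delta * rem x (n * p) - \sum_(j < p) (digit beta x (n * p + j))%:~R * tail j.
Proof.
rewrite mulSnr remD rem_expand bprod_size //; congr (_ - _).
by apply: eq_bigr => j _; rewrite digitD.
Qed.

Lemma finspan_rem x n : finspan (rem x (n * p) - delta ^+ n * x).
Proof.
elim: n => [|n IH]; first by rewrite mul0n expr0 mul1r subrr; exact: finspan0.
have -> : rem x (n.+1 * p) - delta ^+ n.+1 * x = delta ^+ 1 * (rem x (n * p) - delta ^+ n * x) +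
    - \sum_(j < p) (digit beta x (n * p + j))%:~R * tail j.
  by rewrite rem_block exprS; ring.
apply: finspanD; first exact: finspan_mul.
by apply/finspanN/finspan_sum => j; apply/finspan_int/finspan_tail.
Qed.

Lemma finspan1 : finspan 1.
Proof.
have := finspan_tail p.-1; rewrite /tail prednK ?hbeta.1 // big_geq //.
exact.
Qed.

Lemma finspan_ev a : finspan (ev delta a).
Proof.
elim/poly_ind: a => [|a c IH]; first by rewrite rmorph0; exact: finspan0.
rewrite rmorphD rmorphM /= evX evC; apply: finspanD.
  by rewrite mulrC; exact: (finspan_mul _ 1).
by rewrite -[_%:~R]mulr1; apply: finspan_int; exact: finspan1.
Qed.

End Finite.

(** * The tails lie in the fraction field of Z[delta] *)

Section TailField.
Context {R : realType} {beta : seq R}.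
Hypotheses (hbeta : alt_base beta) (hF : propF beta).
Local Notation p := (size beta).
Local Notation b := (bterm beta).
Local Notation rem := (rem_seq beta).
Local Notation delta := (\prod_(c <- beta) c).
Local Notation tail := (@tail R beta).
Variable U : {poly int}.
Hypothesis hU : delta * ev delta U = 1.

Lemma ev_invpoly : ev delta U = delta^-1.
Proof. by apply: (mulfI (delta_neq0 hbeta)); rewrite hU divff // delta_neq0. Qed.

(** The first [n] periods of the expansion, grouped by position within the period. Negative powers
    of delta become powers of [U], so the coefficients are values of integer polynomials. *)
Lemma expand_tails x n : 0 <= x -> exists q : 'I_p -> {poly int},
  (forall j, 0 <= ev delta (q j)) /\
  x = \sum_(j < p) ev delta (q j) * tail j + rem x (n * p) / delta ^+ n.
Proof.
move=> x0; have d0 := delta_neq0 hbeta.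
elim: n => [|n [q [q0 e]]].
  exists (fun _ => 0); split=> [j|]; first by rewrite rmorph0.
  by rewrite mul0n expr0 divr1 big1 ?add0r // => j _; rewrite rmorph0 mul0r.
exists (fun j => q j + (digit beta x (n * p + j))%:P * U ^+ n.+1).
have E j : ev delta (q j + (digit beta x (n * p + j))%:P * U ^+ n.+1) =
    ev delta (q j) + (digit beta x (n * p + j))%:~R / delta ^+ n.+1.
  by rewrite rmorphD rmorphM rmorphXn /= evC ev_invpoly exprVn.
split=> [j|].
  rewrite E addr_ge0 // divr_ge0 // ?ler0z ?digit_ge0 //.
  by rewrite (le_trans ler01) // deltaX_ge1.
under [X in _ = X + _]eq_bigr => j _ do rewrite E mulrDl mulrAC.
rewrite big_split /= -mulr_suml -addrA -mulrDl rem_block //.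
rewrite [X in X / _]addrC subrK exprS -mulf_div divff // mul1r.
exact: e.
Qed.

Lemma approx_from_above (y e : R) : 0 <= y -> 0 < e ->
  exists n m : nat, 0 <= n%:R / delta ^+ m - y < e.
Proof.
move=> y0 e0; have [m hm] := expr_unbounded R delta e^-1 (delta_gt1 hbeta).
have D0 : 0 < delta ^+ m by rewrite exprn_gt0 // delta_gt0.
exists (Num.truncn (y * delta ^+ m)).+1, m.
have /andP[h1 h2] := truncn_itv (mulr_ge0 y0 (ltW D0)).
have h3 : 1 / delta ^+ m < e by rewrite ltr_pdivrMr // -ltr_pdivrMl // mulr1.
apply/andP; split; first by rewrite subr_ge0 ler_pdivlMr // ltW.
rewrite ltrBlDr; apply: le_lt_trans (_ : y + 1 / delta ^+ m < _); last by rewrite addrC ltrD2r.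
rewrite -natr1 mulrDl lerD2r ler_pdivrMr //.
Qed.

(** The difference [y] between [n%:R / delta ^+ m] and the tail is finite by (F), so its expansion
    in tails has no remainder. Each coefficient is at most [y < e], because all terms are
    nonnegative and tails are at least 1. *)
Lemma tail_relation (e : R) (j : 'I_p) : 0 < e <= 1 ->
  exists rq : {poly int} * ('I_p -> {poly int}),
    (forall i, 0 <= ev delta (rq.2 i) < e) /\
    ev delta rq.1 = tail j + \sum_(i < p) ev delta (rq.2 i) * tail i.
Proof.
move=> /andP[e0 e1].
have [n [m /andP[h1 h2]]] := approx_from_above (tail j) e (ltW (tail_gt0 hbeta j)) e0.
set y := _ - _ in h1 h2.
have hr : n%:R / delta ^+ m = ev delta ((n%:Z)%:P * U ^+ m).
  by rewrite rmorphM rmorphXn /= evC ev_invpoly exprVn.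
have /(FinP hbeta)[_ [N hN]] : Fin beta y.
  apply: (finspan_Fin hbeta hF); last by rewrite h1 (lt_le_trans h2).
  rewrite /y hr; apply: finspanD => //; first exact: finspan_ev.
  by apply: finspanN; exact: finspan_tail.
have [q [q0 eq]] := expand_tails y N h1.
have r0 : rem y (N * p) = 0 by apply: rem_eq0_ge hN _; rewrite leq_pmulr // hbeta.1.
rewrite r0 mul0r addr0 in eq.
exists ((n%:Z)%:P * U ^+ m, q) => /=; split; last by rewrite -eq -hr /y addrC subrK.
move=> i; rewrite q0 /=; apply: le_lt_trans h2; rewrite eq (bigD1 i) //=.
apply: le_trans (_ : ev delta (q i) * tail i <= _); first by rewrite ler_peMr ?tail_ge1.
by rewrite lerDl sumr_ge0 // => k _; rewrite mulr_ge0 // ltW // tail_gt0.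
Qed.

(** A kernel vector satisfies v = -vQ, but [Q] shrinks the sum of absolute values by a factor of at
    most n/(n+1). *)
Lemma det_perturbation_neq0 n (Q : 'M[R]_n) :
  (forall i j, 0 <= Q i j < n.+1%:R^-1) -> \det (1%:M + Q) != 0.
Proof.
move=> hQ; apply/negP => /det0P[v v0 hv].
have hvi i : v 0 i = - \sum_j v 0 j * Q j i.
  have := congr1 (fun w : 'rV[R]_n => w 0 i) hv.
  rewrite mulmxDr mulmx1 !mxE => /eqP; rewrite addr_eq0 => /eqP ->.
  by [].
pose S := \sum_i `|v 0 i|.
have S0 : 0 < S.
  rewrite lt_def sumr_ge0 // andbT; apply: contraNneq v0 => /eqP.
  rewrite psumr_eq0 // => /allP h; apply/eqP/rowP => i; rewrite mxE.
  by apply/eqP; rewrite -normr_eq0; apply: h; rewrite mem_index_enum.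
have : S <= S * (n%:R / n.+1%:R).
  rewrite {1}/S; apply: le_trans (_ : \sum_i \sum_j `|v 0 j| * Q j i <= _).
    apply: ler_sum => i _; rewrite hvi normrN (le_trans (ler_norm_sum _ _ _)) //.
    by apply: ler_sum => j _; rewrite normrM (ger0_norm (andP (hQ j i)).1).
  rewrite exchange_big mulr_suml /=; apply: ler_sum => j _.
  rewrite -mulr_sumr ler_wpM2l //.
  apply: le_trans (_ : \sum_(i < n) n.+1%:R^-1 <= _).
    by apply: ler_sum => i _; case/andP: (hQ j i) => _ /ltW.
  by rewrite sumr_const card_ord mulr_natl.
by rewrite -[X in X <= _]mulr1 ler_pM2l // ler_pdivlMr ?ltr0Sn // mul1r ler_nat ltnn.
Qed.

(* Property (F) makes the relations of [tail_relation] available with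
   arbitrarily small coefficients; Cramer's rule then places every [tail j]
   in the fraction field of [int[delta]]. *)
Lemma tails_in_field : exists (g : {poly int}) (f : 'I_p -> {poly int}),
  ev delta g != 0 /\ forall j : 'I_p, ev delta g * tail j = ev delta (f j).
Proof.
have e01 : 0 < (p.+1%:R^-1 : R) <= 1 by rewrite invr_gt0 ltr0Sn invf_le1 // ler1n.
have [rq hrq] := boolp.choice (fun j => tail_relation _ j e01).
pose At : 'M[{poly int}]_p := 1%:M + \matrix_(j, i) (rq j).2 i.
pose rt : 'cV[{poly int}]_p := \col_j (rq j).1.
exists (\det At), (fun j => (\adj At *m rt) j 0).
have eA : map_mx (ev delta) At = 1%:M + \matrix_(j, i) ev delta ((rq j).2 i).
  by rewrite map_mxD map_mx1; congr (_ + _); apply/matrixP => j i; rewrite !mxE.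
rewrite -det_map_mx; split.
  by rewrite eA; apply: det_perturbation_neq0 => i j; rewrite mxE; exact: (hrq i).1.
move=> j.
have hD : map_mx (ev delta) At *m (\col_i tail i) = map_mx (ev delta) rt.
  rewrite eA mulmxDl mul1mx; apply/colP => i; rewrite !mxE (hrq i).2; congr (_ + _).
  by apply: eq_bigr => k _; rewrite !mxE.
have := congr1 (mulmx (\adj (map_mx (ev delta) At))) hD.
rewrite mulmxA mul_adj_mx mul_scalar_mx -map_mx_adj -map_mxM.
by move/(congr1 (fun w : 'cV[R]_p => w j 0)); rewrite !mxE.
Qed.

End TailField.

(** * Uniform bounds over finite lists *)

Lemma uniform_on_seq (T : eqType) (V : Type) (v0 : V) (join : V -> V -> V)
    (Q : T -> V -> Prop) (s : seq T) :
  (forall t u v, Q t u -> Q t (join u v) /\ Q t (join v u)) ->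
  (forall t, t \in s -> exists v, Q t v) ->
  exists v, forall t, t \in s -> Q t v.
Proof.
move=> mono; elim: s => [|t s IH] h; first by exists v0.
have [u hu] := h t (mem_head _ _).
have [v hv] := IH (fun t' ht' => h t' (mem_behead (s := t :: s) ht')).
exists (join u v) => t'; rewrite inE => /predU1P[->|/hv ht']; first exact: (mono _ _ _ hu).1.
exact: (mono _ _ _ ht').2.
Qed.

Lemma norm_bounded_on_seq (R : realType) (w : R[i] -> R[i]) (s : seq R[i]) :
  exists K : R, 0 <= K /\ forall z, z \in s -> `|w z| <= K%:C%C.
Proof.
elim: s => [|t s [K [K0 hK]]]; first by exists 0.
have [c [c0 hc]] := norm_le_real (w t).
exists (c + K); split=> [|z]; first exact: addr_ge0.
rewrite inE => /predU1P[->|/hK hz]; [apply: le_trans hc _|apply: le_trans hz _].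
  by rewrite lecR lerDl.
by rewrite lecR lerDr.
Qed.

Lemma nonzero_gap (R : realType) (s : seq R) :
  exists e : R, 0 < e /\ forall h, h \in s -> h != 0 -> e <= `|h|.
Proof.
elim: s => [|t s [e [e0 he]]]; first by exists 1.
(* A zero entry imposes no constraint and contributes the default 1. *)
exists (Num.min e (if t == 0 then 1 else `|t|)); split.
  by rewrite lt_min e0; case: eqVneq => [_|nt] /=; rewrite ?ltr01 ?normr_gt0.
move=> h; rewrite inE => /predU1P[->|/he hh] nh; rewrite ge_min.
  by rewrite (negPf nh) lexx orbT.
by rewrite hh.
Qed.

(** * Conjugates of the remainders *)

Section Carry.
Context {R : realType} {beta : seq R}.
Hypotheses (hbeta : alt_base beta).
Local Notation p := (size beta).
Local Notation rem := (rem_seq beta).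
Local Notation delta := (\prod_(c <- beta) c).
Local Notation tail := (@tail R beta).
Variables (g : {poly int}) (f : 'I_p -> {poly int}).
Hypothesis hgf : forall j : 'I_p, ev delta g * tail j = ev delta (f j).

(** A polynomial rather than a real number, with [f j] in place of the tails, so that it can also be
    evaluated at the conjugates of delta. *)
Fixpoint carry (x : R) (n : nat) : {poly int} :=
  if n is n'.+1 then
    'X * carry x n' + \sum_(j < p) (digit beta x (n' * p + j))%:P * f j
  else 0.

Lemma carryE (A : comNzRingType) (z : A) x n : ev z (carry x n.+1) =
  z * ev z (carry x n) + \sum_(j < p) (digit beta x (n * p + j))%:~R * ev z (f j).
Proof.
rewrite /= rmorphD rmorphM /= evX rmorph_sum /=; congr (_ + _).
by apply: eq_bigr => j _; rewrite rmorphM /= evC.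
Qed.

(* [carry x n] is [ev delta g] times the integer part removed in the first [n] periods. *)
Lemma rem_carry x n :
  ev delta g * rem x (n * p) = ev delta g * delta ^+ n * x - ev delta (carry x n).
Proof.
elim: n => [|n IH]; first by rewrite /= rmorph0 expr0 mulr1 subr0.
rewrite carryE rem_block // mulrBr mulrCA IH mulr_sumr.
under [X in _ - X = _]eq_bigr => j _ do rewrite mulrCA hgf.
by rewrite exprS; ring.
Qed.

(** Digits are bounded by the bases, so each period multiplies the modulus by r = |z| < 1 and adds
    at most a constant e; the bound e/(1-r) is preserved, whatever [x] and [n] are. *)
Lemma carry_bounded (z : R[i]) : `|z| < 1 -> exists C : R,
  forall x n, 0 <= x < 1 -> `|ev z (carry x n)| <= C%:C%C.
Proof.
have [r [er r0]] : exists r : R, `|z| = r%:C%C /\ 0 <= r.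
  by exists (Num.sqrt (complex.Re z ^+ 2 + complex.Im z ^+ 2)); rewrite normc_def sqrtr_ge0.
rewrite er -[1]/((1 : R)%:C%C) ltcR => r1.
have [e [e0 he]] := norm_le_real (\sum_(j < p) (bterm beta j)%:C%C * `|ev z (f j)|).
exists (e / (1 - r)) => x n x01.
have r1' : 0 < 1 - r by rewrite subr_gt0.
have b0 j : 0 <= (bterm beta j)%:C%C by rewrite -[0]/((0 : R)%:C%C) lecR ltW // bterm_gt0.
elim: n => [|n IH].
  by rewrite /= rmorph0 normr0 -[0]/((0 : R)%:C%C) lecR divr_ge0 // ltW.
rewrite carryE (le_trans (ler_normD _ _)) //.
have -> : e / (1 - r) = r * (e / (1 - r)) + e by field; rewrite gt_eqF.
rewrite rmorphD rmorphM /= lerD //.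
  by rewrite normrM er ler_wpM2l // -[0]/((0 : R)%:C%C) lecR.
apply: le_trans he; apply: le_trans (ler_norm_sum _ _ _) _.
rewrite [leRHS]ger0_norm; last by apply: sumr_ge0 => j _; rewrite mulr_ge0.
apply: ler_sum => j _; rewrite normrM ler_wpM2r //.
rewrite ger0_norm ?ler0z ?digit_ge0 //; last by case/andP: x01.
have -> : (digit beta x (n * p + j))%:~R = ((digit beta x (n * p + j))%:~R : R)%:C%C.
  by rewrite rmorph_int.
by rewrite lecR -(bterm_addM _ n) digit_le.
Qed.

End Carry.

(** * Pure periodicity for the base itself *)

Section PurePeriodicity.
Context {R : realType} {beta : seq R}.
Hypotheses (hbeta : alt_base beta) (hF : propF beta).
Local Notation p := (size beta).
Local Notation rem := (rem_seq beta).
Local Notation delta := (\prod_(c <- beta) c).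

(** This is [rem_sub] applied to the last [m] of the [l] periods. *)
Lemma rem_sub_period x l m : 0 <= x < 1 -> (m <= l)%N -> x <= rem x (l * p) ->
  0 <= rem x ((l - m) * p) - x / delta ^+ m < 1 /\
  rem (rem x ((l - m) * p) - x / delta ^+ m) (m * p) = rem x (l * p) - x.
Proof.
move=> /andP[x0 x1] ml; set y := rem x ((l - m) * p).
have /andP[y0 y1] : 0 <= y < 1 by apply: rem_itv; rewrite x0.
have -> : rem x (l * p) = rem y (m * p) by rewrite -remD -mulnDl subnK.
move=> xle; have D0 : 0 < delta ^+ m by rewrite exprn_gt0 // delta_gt0.
split; last by rewrite -bprodMsize // rem_sub // x0.
rewrite subr_ge0 ler_pdivrMr // (le_trans xle) /=; last first.
  by rewrite mulrC -bprodMsize // rem_le.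
by apply: le_lt_trans y1; rewrite gerBl divr_ge0 // ltW.
Qed.

Lemma propPP_of_propF : pisot_unit delta -> propPP beta.
Proof.
move=> [_ [P [Pm [Pirr [Pd [P0 Proots]]]]]].
have d0 := delta_neq0 hbeta; have dgt0 := delta_gt0 _ hbeta.
rewrite -/(ev _ _) in Pd.
have [U hU] := exists_inverse_poly P P0.
have [g [f [gd hgf]]] := tails_in_field hbeta hF U (hU _ _ Pd).
have Ud : ev delta U = delta^-1 by apply: ev_invpoly => //; exact: hU.
have [rs [_ _ hrs]] := @complex_roots R P Pm Pirr.
pose dC : R[i] := delta%:C%C.
have [C0 hC0] : exists C0 : R, forall z, z \in rs -> z != dC ->
    forall x n, 0 <= x < 1 -> `|ev z (carry f x n)| <= C0%:C%C.
  apply: (@uniform_on_seq _ _ 0 Num.max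
    (fun z C => z != dC -> forall x n, 0 <= x < 1 -> `|ev z (carry f x n)| <= C%:C%C)).
    move=> z u v hz; split=> nz x n x01; apply: le_trans (hz nz x n x01) _;
    by rewrite lecR le_max lexx ?orbT.
  move=> z /hrs zP; case: (eqVneq z dC) => [|nz]; first by exists 0.
  have [C hC] := carry_bounded hbeta f z (Proots z zP nz).
  by exists C => _; exact: hC.
(* The first entry serves at delta itself, where |h_k| <= 1. At the other roots [C0] bounds the
   carry, and 1 will bound the contribution of [x]. *)
pose C := Num.max `|ev delta g| (C0 + 1).
have [H0 hH0] := @finite_bounded_conjugates R P Pm Pirr delta C Pd.
pose H := [seq h / ev delta g | h <- H0].
have [L hL] : exists L : nat, forall h, h \in H ->
    finspan (beta := beta) h -> 0 <= h < 1 -> rem h (L * p) = 0.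
  apply: (@uniform_on_seq _ _ 0%N maxn
    (fun h L => finspan (beta := beta) h -> 0 <= h < 1 -> rem h (L * p) = 0)).
    move=> h u v hh; split=> sh h01; apply: rem_eq0_ge (hh sh h01) _;
    by rewrite leq_mul2r ?leq_maxl ?leq_maxr orbT.
  move=> h _; case: (boolp.pselect (finspan (beta := beta) h /\ 0 <= h < 1)) => [[sh h01]|nh].
    have /(FinP hbeta)[_ [N hN]] := finspan_Fin hbeta hF _ sh h01.
    by exists N => _ _; apply: rem_eq0_ge hN _; rewrite leq_pmulr // hbeta.1.
  by exists 0%N => sh h01; case: nh.
(* [H] and [L] are fixed before [m]; the constants depending on [m] only affect [gamma]. The
   successor makes [m], hence [l], positive. *)
pose m := L.+1.
have [e [e0 he]] := @nonzero_gap R H.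
have [K1 [K10 hK1]] := @norm_bounded_on_seq R (fun z => ev z g) rs.
have [K2 [K20 hK2]] := @norm_bounded_on_seq R (fun z => ev z g * ev z U ^+ m) rs.
pose K := K1 + K2 + 1.
have K0 : 0 < K by rewrite /K; lra.
(* The bound by [e] will exclude a negative [h 0], and the last one gives 2Kx <= 1 in the estimate
   of the conjugates. *)
pose gamma := Num.min 1 (Num.min e (K *+ 2)^-1).
have ga0 : 0 < gamma by rewrite !lt_min ltr01 e0 invr_gt0 mulr2n addr_gt0.
exists gamma; split=> // q q0; rewrite !lt_min => /and3P[q1 qe qK].
set x : R := ratr q in q0 q1 qe qK *.
have x01 : 0 <= x < 1 by rewrite q0.
pose N := `|denq q|%N; pose c := numq q.
have N0 : (0 < N)%N by rewrite absz_gt0 denq_neq0.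
have [l [S [ml hS]]] := pow_sub1_divisible P Pm U N m N0 (ltn0Sn L).
have xN : x * N%:R = c%:~R.
  by rewrite /x /ratr -[N%:R]/((N%:Z)%:~R) absz_denq divfK // intr_eq0 denq_neq0.
have hxS (A : comNzRingType) (z : A) (y : A) : ev z P = 0 -> y * N%:R = c%:~R ->
    y * (z ^+ l - 1) = c%:~R * ev z S.
  by move=> zP yN; rewrite hS ?hU // mulrA yN.
(* At delta this is [ev delta g * h k]; its values at the other roots are the conjugates to be
   bounded. *)
pose a k := g * (c%:P * S) * U ^+ k - carry f x (l - k).
pose h k := rem x ((l - k) * p) - x / delta ^+ k.
have ha k : (k <= l)%N -> ev delta (a k) = ev delta g * h k.
  move=> kl; rewrite rmorphB !rmorphM rmorphXn /= evC Ud -(hxS _ _ x) //.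
  rewrite /h [RHS]mulrBr (rem_carry g f hgf).
  have dk0 := expf_neq0 k d0.
  rewrite exprVn (_ : delta ^+ l = delta ^+ (l - k) * delta ^+ k); last by rewrite -exprD subnK.
  by field.
have hH k : (k <= l)%N -> (forall z, z \in rs -> `|ev z g * ev z U ^+ k| <= K%:C%C) ->
    `|h k| <= 1 -> h k \in H.
  move=> kl hK hk1; apply/mapP; exists (ev delta (a k)); last by rewrite ha // mulrC mulKf.
  apply: hH0 => z zP; case: (eqVneq z dC) => [->|nz].
    rewrite /dC (ev_morph _ _ (real_complex R)) ha //=.
    rewrite normc_def /= expr0n addr0 sqrtr_sqr lecR le_max normrM.
    by rewrite ler_piMr.
  have zrs : z \in rs by apply/hrs.
  have yN : x%:C%C * N%:R = c%:~R :> R[i].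
    by rewrite -(rmorph_nat (real_complex R)) -rmorphM /= xN rmorph_int.
  rewrite rmorphB !rmorphM rmorphXn /= evC -(hxS _ _ x%:C%C) //.
  apply: le_trans (ler_normB _ _) _.
  apply: le_trans (_ : (1 + C0)%:C%C <= _); last by rewrite lecR le_max addrC lexx orbT.
  rewrite rmorphD /= lerD ?hC0 //.
  rewrite (mulrC (ev z g)) -mulrA mulrC normrM.
  apply: le_trans (_ : K%:C%C * (x *+ 2)%:C%C <= _); last first.
    rewrite -rmorphM lecR.
    by move: (ltW qK); rewrite -[(K *+ 2)^-1]div1r ler_pdivlMr ?pmulrn_lgt0 // !mulrnAr mulrC.
  apply: ler_pM => //; first exact: hK.
  rewrite normrM normc_def /= expr0n addr0 sqrtr_sqr ger0_norm // rmorphMn /= -mulr_natr.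
  apply: ler_wpM2l; first by rewrite -[0]/((0 : R)%:C%C) lecR.
  apply: le_trans (ler_normB _ _) _; rewrite normr1 normrX (natrD _ 1 1) lerD2r.
  by rewrite exprn_ile1 // ltW // Proots.
have /andP[r0 r1] : 0 <= rem x (l * p) < 1 by apply: rem_itv.
have KC1 z : z \in rs -> `|ev z g * ev z U ^+ 0| <= K%:C%C.
  by move=> zrs; rewrite mulr1 (le_trans (hK1 z zrs)) // lecR /K; lra.
have KCm z : z \in rs -> `|ev z g * ev z U ^+ m| <= K%:C%C.
  by move=> zrs; rewrite (le_trans (hK2 z zrs)) // lecR /K; lra.
(* Otherwise [h 0] is a nonzero element of [H] of modulus at most [x], which is below the gap
   [e]. *)
have xle : x <= rem x (l * p).
  rewrite leNgt; apply/negP => ltx.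
  have h0 : h 0 = rem x (l * p) - x by rewrite /h subn0 divr1.
  have h0n : `|h 0| = x - rem x (l * p) by rewrite h0 distrC ger0_norm // subr_ge0 ltW.
  have hin : h 0 \in H by apply: hH => //; rewrite h0n; lra.
  have : e <= `|h 0| by apply: he => //; rewrite h0 subr_eq0 lt_eqF.
  by rewrite h0n; lra.
have [h01 hrem] := rem_sub_period x l m x01 ml xle.
have hin : h m \in H.
  by apply: hH => //; rewrite ger0_norm; case/andP: h01 => // _ /ltW.
(* [h m] differs from the remainder minus [delta ^+ (l - m) * x] by x (delta^l - 1) / delta^m, and x
   (delta^l - 1) lies in Z[delta]. *)
have hspan : finspan (beta := beta) (h m).
  have -> : h m = (rem x ((l - m) * p) - delta ^+ (l - m) * x) +
      ev delta (c%:P * S) / delta ^+ m.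
    rewrite rmorphM /= evC -(hxS _ _ x) // /h.
    have dm0 := expf_neq0 m d0.
    rewrite (_ : delta ^+ l = delta ^+ (l - m) * delta ^+ m); last by rewrite -exprD subnK.
    by field.
  apply: finspanD => //; first exact: finspan_rem.
  by apply: finspan_div => //; exact: finspan_ev.
have := rem_eq0_ge _ _ _ (m * p) (hL _ hin hspan h01).
rewrite leq_mul2r leqnSn orbT => /(_ isT); rewrite hrem => /eqP.
rewrite subr_eq0 => /eqP remx.
exists (l * p)%N; split; first by rewrite muln_gt0 hbeta.1 (leq_trans _ ml).
by move=> k; rewrite addnC digitD remx.
Qed.

End PurePeriodicity.

(** * Rotation of the base *)

Section Rotation.
Context {R : realType} {beta : seq R}.
Hypotheses (hbeta : alt_base beta).
Variable i : nat.
Hypothesis ip : (i < size beta)%N.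

Lemma alt_base_rot : alt_base (rot i beta).
Proof. by split=> [|c]; rewrite ?size_rot ?mem_rot; [exact: hbeta.1|exact: hbeta.2]. Qed.

Lemma bterm_rot k : bterm (rot i beta) k = bterm beta (i + k).
Proof.
rewrite /bterm size_rot -modnDmr.
have : (k %% size beta < size beta)%N by rewrite ltn_pmod // hbeta.1.
move: (k %% size beta)%N => r rp.
rewrite /rot nth_cat size_drop nth_drop.
case: ltnP => h; first by rewrite modn_small // -ltn_subRL.
have lt : (r - (size beta - i) < i)%N by rewrite ltn_subLR // subnK // ltnW.
have -> : (i + r = size beta + (r - (size beta - i)))%N.
  by rewrite addnBA // subnBA ?(ltnW ip) // -addnA addKn addnC.
by rewrite nth_take // modnDl modn_small // (ltn_trans lt).
Qed.

Lemma rem_rot x k : rem_seq beta x (i + k) = rem_seq (rot i beta) (rem_seq beta x i) k.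
Proof.
elim: k => [|k IH]; first by rewrite addn0.
by rewrite addnS !remS /digit IH bterm_rot.
Qed.

(** The expansion of [x / bprod beta i] consists of [i] zeros followed by the expansion of [x] in
    the rotated base. As the scaling is additive, this carries (F) over. *)
Lemma Fin_rot x : 0 <= x < 1 -> Fin (rot i beta) x <-> Fin beta (x / bprod beta i).
Proof.
move=> x01; rewrite (FinP alt_base_rot) (FinP hbeta); split=> -[_ [N hN]].
  split; first by rewrite div_itv // bprod_ge1.
  by exists (i + N)%N; rewrite rem_rot rem_div.
split=> //; exists N; rewrite -[x in LHS](rem_div _ hbeta x i) // -rem_rot.
by apply: rem_eq0_ge hN _; rewrite leq_addl.
Qed.

Lemma propF_rot : propF beta -> propF (rot i beta).
Proof.
move=> hF x y fx fy.
have [hD hB] := hF _ _ ((Fin_rot x fx.1).1 fx) ((Fin_rot y fy.1).1 fy).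
split=> xy01; apply/Fin_rot => //.
  by rewrite mulrDl; apply: hD; rewrite -mulrDl div_itv // bprod_ge1.
by rewrite mulrBl; apply: hB; rewrite -mulrBl div_itv // bprod_ge1.
Qed.

End Rotation.

Theorem theoremC (R : realType) (beta : seq R) :
  alt_base beta -> propF beta -> pisot_unit (\prod_(b <- beta) b) ->
  forall i : nat, (i < size beta)%N -> propPP (rot i beta).
Proof.
move=> hbeta hF hpisot i ip.
(* Only the Pisot condition is left, and rotation does not change the product. *)
apply: propPP_of_propF (alt_base_rot hbeta i) (propF_rot hbeta i ip hF) _.
by rewrite (perm_big beta) // perm_rot.
Qed.
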